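(* Let $W\in\mathbb{R}^{d_L\times d_0}$ and let $S_{\underline{r}}$ be a stratum in the rank stratification of $\mu^{-1}(W)$. For any two points $\theta,\theta'\in S_{\underline{r}}$, there is a linear homeomorphism from $S_{\underline{r}}$ to itself that maps $\theta$ to $\theta'$.
   Context: Fix integers $L\ge1$ and $d_0,\ldots,d_L\ge1$. The weight space is $\mathbb{R}^{d_\theta}=\mathbb{R}^{d_L\times d_{L-1}}\times\cdots\times\mathbb{R}^{d_1\times d_0}$, $d_\theta=\sum_{j=1}^Ld_jd_{j-1}$; a weight vector is $\theta=(W_L,\ldots,W_1)$ with $W_j\in\mathbb{R}^{d_j\times d_{j-1}}$. The matrix multiplication map is $\mu(\theta)=W_LW_{L-1}\cdots W_1$ and $\mu^{-1}(W)=\{\theta\in\mathbb{R}^{d_\theta}:\mu(\theta)=W\}$. For $L\ge k\ge i\ge0$, $W_{k\sim i}=W_kW_{k-1}\cdots W_{i+1}$, with $W_{k\sim k}=I_{d_k\times d_k}$. The rank list of $\theta$ is the family $\langle\operatorname{rk}W_{k\sim i}\rangle_{L\ge k\ge i\ge0}$. For a rank list $\underline{r}$, the stratum is $S_{\underline{r}}=\{\theta\in\mu^{-1}(W):\text{the rank list of }\theta\text{ is }\underline{r}\}$; the rank stratification of $\mu^{-1}(W)$ is the set of all $S_{\underline{r}}$ with $\underline{r}$ the rank list of some weight vector in $\mu^{-1}(W)$. A linear homeomorphism from $S_{\underline{r}}$ to itself means the restriction to $S_{\underline{r}}$ of a linear bijection $\mathbb{R}^{d_\theta}\to\mathbb{R}^{d_\theta}$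 that maps $S_{\underline{r}}$ onto itself. *)

(* Defs.v *)
From HB Require Import structures.
From mathcomp Require Import all_boot all_order all_algebra.
From mathcomp Require Import boolp classical_sets reals.

Set Implicit Arguments.
Unset Strict Implicit.
Unset Printing Implicit Defensive.

Import GRing.Theory.
Local Open Scope classical_set_scope.
Local Open Scope ring_scope.

(* The factors are indexed from 0: the component of index j : 'I_L of theta
   is the matrix W_(j+1), of size d_(j+1) x d_j. Only d_0, ..., d_L matter,
   although d is a total function on nat. *)
Definition weight (F : fieldType) (L : nat) (d : nat -> nat) : Type :=
  {dffun forall j : 'I_L, 'M[F]_(d j.+1, d j)}.

Section WeightSpace.
Variables (F : fieldType) (L : nat) (d : nat -> nat).
Implicit Types theta eta : weight F L d.

HB.instance Definition _ := Choice.copy (weight F L d)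
  {dffun forall j : 'I_L, 'M[F]_(d j.+1, d j)}.

Definition weight_zero : weight F L d :=
  [ffun j : 'I_L => (0 : 'M[F]_(d j.+1, d j))].
Definition weight_opp theta : weight F L d := [ffun j => - theta j].
Definition weight_add theta eta : weight F L d := [ffun j => theta j + eta j].
Definition weight_scale (a : F) theta : weight F L d :=
  [ffun j => a *: theta j].

Fact weight_addA : associative weight_add.
Proof. by move=> x y z; apply/ffunP => j; rewrite !ffunE addrA. Qed.
Fact weight_addC : commutative weight_add.
Proof. by move=> x y; apply/ffunP => j; rewrite !ffunE addrC. Qed.
Fact weight_add0 : left_id weight_zero weight_add.
Proof. by move=> x; apply/ffunP => j; rewrite !ffunE add0r. Qed.
Fact weight_addN : left_inverse weight_zero weight_opp weight_add.
Proof. by move=> x; apply/ffunP => j; rewrite !ffunE addNr. Qed.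

HB.instance Definition _ := GRing.isZmodule.Build (weight F L d)
  weight_addA weight_addC weight_add0 weight_addN.

Fact weight_scaleA a b theta :
  weight_scale a (weight_scale b theta) = weight_scale (a * b) theta.
Proof. by apply/ffunP => j; rewrite !ffunE scalerA. Qed.
Fact weight_scale1 : left_id 1 weight_scale.
Proof. by move=> x; apply/ffunP => j; rewrite !ffunE scale1r. Qed.
Fact weight_scaleDr : right_distributive weight_scale +%R.
Proof. by move=> a x y; apply/ffunP => j; rewrite !ffunE scalerDr. Qed.
Fact weight_scaleDl theta :
  {morph weight_scale^~ theta : a b / a + b >-> a + b}.
Proof. by move=> a b; apply/ffunP => j; rewrite !ffunE scalerDl. Qed.

HB.instance Definition _ := GRing.Zmodule_isLmodule.Build F (weight F L d)
  weight_scaleA weight_scale1 weight_scaleDr weight_scaleDl.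

(* W_(j+1) for every j : nat, with the junk value 0 when L <= j. *)
Definition factor theta (j : nat) : 'M[F]_(d j.+1, d j) :=
  if @idP (j < L)%N is ReflectT lt_jL then theta (Ordinal lt_jL) else 0.

(* subprod theta k i is W_(k~i) = W_k ... W_(i+1) when i <= k. The
   rectangular pid_mx avoids a cast at k = i, where it is the identity (see
   subprodkk); the values for k < i are junk. *)
Fixpoint subprod theta (k i : nat) : 'M[F]_(d k, d i) :=
  match k with
  | 0 => pid_mx (d i)
  | k'.+1 => if (i <= k')%N then factor theta k' *m subprod theta k' i
             else pid_mx (d i)
  end.

Lemma factorE theta (j : 'I_L) : factor theta j = theta j.
Proof.
rewrite /factor; case: {-}_ / idP => [lt_jL|/(_ (ltn_ord j))//].
by case: j lt_jL => j p q; rewrite (bool_irrelevance q p).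
Qed.

Lemma subprodkk theta k : subprod theta k k = 1%:M.
Proof. by case: k => [|k] /=; rewrite ?ltnn pid_mx_1. Qed.

Lemma subprodS theta k i : (i <= k)%N ->
  subprod theta k.+1 i = factor theta k *m subprod theta k i.
Proof. by move=> /= ->. Qed.

Definition mu theta : 'M[F]_(d L, d 0) := subprod theta L 0.

Definition fiber (W : 'M[F]_(d L, d 0)) : set (weight F L d) :=
  [set theta | mu theta = W].

(* The pairs (k, i) with L >= k >= i >= 0. *)
Definition rank_index : Type := {ki : 'I_L.+1 * 'I_L.+1 | (ki.2 <= ki.1)%N}.

Definition rank_list theta : {ffun rank_index -> nat} :=
  [ffun ki : rank_index => \rank (subprod theta (val ki).1 (val ki).2)].

Definition stratum (W : 'M[F]_(d L, d 0)) (r : {ffun rank_index -> nat}) :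
    set (weight F L d) :=
  [set theta | fiber W theta /\ rank_list theta = r].

Definition rank_stratification (W : 'M[F]_(d L, d 0)) :
    set (set (weight F L d)) :=
  [set stratum W (rank_list theta) | theta in fiber W].

End WeightSpace.

(* Main.v *)
(* Two weight vectors of equal rank list are isomorphic as representations of
   the linear quiver d_0 -> ... -> d_L: there are invertible J_0, ..., J_L with
   J_(j+1) W'_(j+1) = W_(j+1) J_j. The base change by J is then the required
   linear bijection: it sends theta to theta' and preserves all subproduct
   ranks, and it preserves the fiber of W because the single equation
   mu(theta) = mu(theta') = W already forces J_L W = W J_0.
   The J_j are built by induction on j, requiring in addition that J_j carry
   the flag of row spaces of the W_(k~j), k = L, ..., j, onto that of the
   W'_(k~j). The inductive step lifts J_j through W_(j+1) and W'_(j+1), one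
   member of the flag at a time. *)
Require Import Defs.
From mathcomp Require Import all_boot all_order all_algebra.
From mathcomp Require Import boolp classical_sets reals.
From HB Require Import structures.

Local Open Scope classical_set_scope.
Local Open Scope ring_scope.

Import GRing.Theory.

(** * Lifting linear maps along a flag of subspaces *)

Section FlagLift.
Context {F : fieldType}.

Lemma row_free_basis {m n r : nat} (U : 'M[F]_(m, n)) : \rank U = r ->
  exists2 C : 'M[F]_(r, n), row_free C & (C :=: U)%MS.
Proof.
by move=> <-; exists (row_base U); [exact: row_base_free | exact: eq_row_base].
Qed.

(** [J] is corrected by a term that factors through the projection onto [C] along [A]: it vanishes
    on [A] and, as [C] is row free, can be prescribed on [C]. *)
Lemma extend_mx {m r n q : nat} {A : 'M[F]_(m, n)} {C : 'M[F]_(r, n)}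
    (J : 'M[F]_(n, q)) (T : 'M[F]_(r, q)) :
  row_free C -> (A :&: C)%MS = 0 ->
  exists K : 'M[F]_(n, q), A *m K = A *m J /\ C *m K = T.
Proof.
move=> freeC AC0.
have CA0 : (<<C>> :&: <<A>>)%MS = 0.
  apply/eqP; rewrite -submx0 -AC0 sub_capmx.
  rewrite (submx_trans (capmxSr _ _)) ?genmxE //.
  by rewrite (submx_trans (capmxSl _ _)) ?genmxE.
exists (J + proj_mx <<C>>%MS <<A>>%MS *m (pinvmx C *m (T - C *m J))).
split; rewrite mulmxDr mulmxA.
  by rewrite proj_mx_0 ?genmxE // mul0mx addr0.
rewrite proj_mx_id ?genmxE // mulmxA mulmxVp // mul1mx.
by rewrite addrC subrK.
Qed.

(* B is A + C + E with C a complement of A :&: ker p in B :&: ker p. Only the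
   image of C has to be chosen with care, so as to reach all of B' :&: ker p';
   any lift of p on E along p' will do. *)
Lemma lift_step {n q : nat} {p p' : 'M[F]_(n, q)} {J A A' B B' : 'M[F]_n} :
  (A <= B)%MS -> (A' <= B')%MS -> \rank A = \rank A' -> \rank B = \rank B' ->
  (A *m J :=: A')%MS -> A *m J *m p' = A *m p -> (B *m p :=: B' *m p')%MS ->
  exists K : 'M[F]_n,
    [/\ A *m K = A *m J, (B *m K :=: B')%MS & B *m K *m p' = B *m p].
Proof.
move=> sAB sA'B' rkA rkB AJ AJp Bp.
have Ap : (A *m p :=: A' *m p')%MS by rewrite -AJp; exact: eqmxMr.
set D := (B :&: kermx p)%MS; set D' := (B' :&: kermx p')%MS.
(* Rank-nullity on [B], then on [A], gives the complements [C] and [C'] the same rank, so that [C]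
   can be sent onto [C']. *)
have rkD : \rank D = \rank D'.
  by apply: (@addnI (\rank (B *m p))); rewrite {2}Bp !mxrank_mul_ker.
have rkDA : \rank (D :&: A) = \rank (D' :&: A').
  have capDA (U V : 'M[F]_n) (f : 'M[F]_(n, q)) : (U <= V)%MS ->
      \rank ((V :&: kermx f) :&: U) = \rank (U :&: kermx f).
    move=> sUV; rewrite capmxC capmxA.
    by have/capmx_idPl := sUV => /(cap_eqmx) /(_ (eqmx_refl (kermx f))) ->.
  rewrite !capDA //.
  by apply: (@addnI (\rank (A *m p))); rewrite {2}Ap !mxrank_mul_ker.
have rkC : \rank (D' :\: A') = \rank (D :\: A).
  by apply: (@addnI (\rank (D :&: A))); rewrite {1}rkDA !mxrank_cap_compl.
have [C freeC defC] := row_free_basis (D :\: A)%MS erefl.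
have [C' _ defC'] := row_free_basis (D' :\: A')%MS rkC.
have sCD : (C <= D)%MS by rewrite defC diffmxSl.
have sC'D' : (C' <= D')%MS by rewrite defC' diffmxSl.
have AC0 : (A :&: C)%MS = 0.
  apply/eqP; rewrite -submx0 -(capmx_diff D A) capmxC.
  by rewrite capmxS // defC.
have [K1 [AK1 CK1]] := extend_mx J C' freeC AC0.
have [E freeE defE] := row_free_basis (B :\: (A + C))%MS erefl.
have sEB : (E <= B)%MS by rewrite defE diffmxSl.
have ACE0 : ((A + C) :&: E)%MS = 0.
  apply/eqP; rewrite -submx0 -(capmx_diff B (A + C)%MS) capmxC.
  by rewrite capmxS // defE.
(* [X *m B'] is the lift of [E *m p] along [p'] inside [B']. *)
have /submxP[X Ep] : (E *m p <= B' *m p')%MS by rewrite -Bp submxMr.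
have [K [ACK EK]] := extend_mx K1 (X *m B') freeE ACE0.
have subK m (U : 'M[F]_(m, n)) : (U <= A + C)%MS -> U *m K = U *m K1.
  by case/submxP=> Y ->; rewrite -!mulmxA ACK.
have AK : A *m K = A *m J by rewrite subK ?addsmxSl.
have CK : C *m K = C' by rewrite subK ?addsmxSr.
have sBsum : (B <= A + C + E)%MS.
  rewrite -(addsmx_diff_cap_eq B (A + C)%MS) addsmx_sub.
  by rewrite -defE addsmxSr (submx_trans (capmxSr _ _)) ?addsmxSl.
(* It suffices that [K *m p' - p] vanishes on [A], [C] and [E]; on [C] both terms are zero, since
   [C] and its image [C'] lie in the kernels. *)
have BKp : B *m K *m p' = B *m p.
  apply/eqP; rewrite -subr_eq0 -mulmxA -mulmxBr -sub_kermx.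
  apply: submx_trans sBsum _; rewrite !addsmx_sub !sub_kermx !mulmxBr !mulmxA.
  rewrite AK AJp CK EK Ep mulmxA !subrr !eqxx andbT /=.
  have/sub_kermxP -> : (C <= kermx p)%MS.
    exact: submx_trans sCD (capmxSr _ _).
  have/sub_kermxP -> : (C' <= kermx p')%MS.
    exact: submx_trans sC'D' (capmxSr _ _).
  by rewrite subrr.
have sBKB' : (B *m K <= B')%MS.
  apply: submx_trans (submxMr K sBsum) _.
  rewrite addsmxMr addsmx_sub (addsmxMr A C) addsmx_sub.
  rewrite AK AJ sA'B' CK EK submxMl andbT /=.
  exact: submx_trans sC'D' (capmxSl _ _).
have sCB : (C <= B)%MS by exact: submx_trans sCD (capmxSl _ _).
have sD'BK : (D' <= B *m K)%MS.
  rewrite -(addsmx_diff_cap_eq D' A') addsmx_sub -defC' -CK submxMr //=.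
  by apply: submx_trans (capmxSr _ _) _; rewrite -AJ -AK submxMr.
exists K; split=> //; apply/eqmxP; rewrite sBKB' /=.
(* Modulo the row space of [B *m K], every row of [B'] is a vector of [D'], and [D'] is already
   reached. *)
have /submxP[Y B'p] : (B' *m p' <= B *m K *m p')%MS by rewrite BKp Bp.
rewrite -[B'](subrK (Y *m (B *m K))) addmx_sub ?submxMl //.
apply: submx_trans sD'BK; rewrite sub_capmx sub_kermx mulmxBl -mulmxA -B'p.
rewrite subrr eqxx andbT addmx_sub //.
by rewrite eqmx_opp; exact: mulmx_sub.
Qed.

(** Induction on the length of the flag: the map obtained by [lift_step] agrees with the previous
    one on [G T], hence on all smaller members. *)
Lemma flag_lift {n q : nat} (p p' : 'M[F]_(n, q)) (T : nat)
    (G G' : nat -> 'M[F]_n) :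
  (forall t, (t < T)%N -> (G t <= G t.+1)%MS) ->
  (forall t, (t < T)%N -> (G' t <= G' t.+1)%MS) ->
  (forall t, (t <= T)%N -> \rank (G t) = \rank (G' t)) ->
  (forall t, (t <= T)%N -> (G t *m p :=: G' t *m p')%MS) ->
  exists K : 'M[F]_n,
    (forall t, (t <= T)%N -> (G t *m K :=: G' t)%MS) /\
    G T *m K *m p' = G T *m p.
Proof.
elim: T => [|T IHT] chain chain' rk Gp.
  have [|||||||K [_ GK GKp]] := @lift_step _ _ p p' 0 0 0 (G 0%N) (G' 0%N);
    rewrite ?sub0mx ?mulmx0 ?mul0mx //; [exact: rk | exact: Gp |].
  by exists K; split=> // -[|].
have [||||J [GJ GJp]] := IHT.
- by move=> t /ltnW; exact: chain.
- by move=> t /ltnW; exact: chain'.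
- by move=> t /leqW; exact: rk.
- by move=> t /leqW; exact: Gp.
have [K [GK GTK GTKp]] := lift_step (chain _ (leqnn _)) (chain' _ (leqnn _))
  (rk _ (leqnSn _)) (rk _ (leqnn _)) (GJ _ (leqnn _)) GJp (Gp _ (leqnn _)).
have chainT t : (t <= T)%N -> (G t <= G T)%MS.
  elim: T {IHT Gp J GJ GJp K GK GTK GTKp rk chain'} chain t => [|T IHT] chain t.
    by rewrite leqn0 => /eqP ->.
  rewrite leq_eqVlt => /predU1P[-> //|ltT].
  apply: submx_trans (chain _ (leqnSn _)).
  by apply: IHT => // s /leqW; exact: chain.
exists K; split=> // t; rewrite leq_eqVlt => /predU1P[-> //|].
move=> letT; have /submxP[Y defGt] := chainT _ letT.
by rewrite defGt -mulmxA GK mulmxA -defGt; exact: GJ.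
Qed.

End FlagLift.

(** * Isomorphism of weight vectors with equal rank lists *)

Section WeightIsomorphism.
Context {F : fieldType} {L : nat} {d : nat -> nat}.
Implicit Types theta eta : weight F L d.

Lemma subprod_recr theta k i : (i < k)%N ->
  subprod theta k i = subprod theta k i.+1 *m factor theta i.
Proof.
elim: k => // k IHk; rewrite ltnS leq_eqVlt => /predU1P[->|lt_ik].
  by rewrite subprodS // !subprodkk mul1mx mulmx1.
by rewrite !(subprodS, IHk) ?mulmxA // ltnW.
Qed.

Lemma rank_listP {theta eta} : rank_list theta = rank_list eta <->
  forall k i, (i <= k <= L)%N ->
    \rank (subprod theta k i) = \rank (subprod eta k i).
Proof.
split=> [/ffunP rk k i /andP[le_ik le_kL]|rk]; last first.
  apply/ffunP => -[[k i] /= le_ik]; rewrite !ffunE /= rk //.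
  by rewrite le_ik -ltnS ltn_ord.
pose ki : 'I_L.+1 * 'I_L.+1 := (inord k, inord i).
have le_ki : (ki.2 <= ki.1)%N by rewrite /= !inordK // ltnS (leq_trans le_ik).
have := rk (exist _ ki le_ki).
by rewrite !ffunE /= !inordK // ltnS (leq_trans le_ik).
Qed.

Lemma subprod_chain theta k i : (i <= k)%N ->
  (subprod theta k.+1 i <= subprod theta k i)%MS.
Proof. by move=> le_ik; rewrite subprodS // submxMl. Qed.

(* The flag is listed from k = L down to k = i, where it is the full space. *)
Lemma subprod_flag_lift {theta theta'} {q i : nat}
    (p p' : 'M[F]_(d i, q)) :
  rank_list theta = rank_list theta' -> (i <= L)%N ->
  (forall k, (i <= k <= L)%N ->
    (subprod theta k i *m p :=: subprod theta' k i *m p')%MS) ->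
  exists K : 'M[F]_(d i), [/\ K \in unitmx, K *m p' = p & forall k,
    (i <= k <= L)%N -> (subprod theta k i *m K :=: subprod theta' k i)%MS].
Proof.
move=> /rank_listP rk le_iL defp.
(* The sizes of the subproducts vary with [t]; [<<_>>] turns them into square matrices of one size
   with the same row spaces. *)
pose G eta t := (<<subprod eta (L - t) i>>)%MS.
have GE eta t : (G eta t :=: subprod eta (L - t) i)%MS by exact: genmxE.
have ranget t : (t <= L - i)%N -> (i <= L - t <= L)%N.
  by move=> le_t; rewrite leq_subr andbT -{1}(subKn le_iL) leq_sub2l.
have chain eta t : (t < L - i)%N -> (G eta t <= G eta t.+1)%MS.
  move=> lt_t; rewrite !GE -(@prednK (L - t)); last first.
    by rewrite subn_gt0 (leq_trans lt_t) ?leq_subr.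
  by rewrite -subnS subprod_chain //; case/andP: (ranget _ lt_t).
have [||||K [GK GKp]] := @flag_lift _ _ _ p p' (L - i) (G theta) (G theta').
- exact: chain.
- exact: chain.
- by move=> t le_t; rewrite !GE rk ?ranget.
- move=> t le_t; apply: eqmx_trans (eqmxMr _ (GE _ _)) _.
  apply: eqmx_trans (defp _ (ranget _ le_t)) _.
  exact: eqmx_sym (eqmxMr _ (GE _ _)).
have flagK k : (i <= k <= L)%N ->
    (subprod theta k i *m K :=: subprod theta' k i)%MS.
  case/andP=> le_ik le_kL; rewrite -(subKn le_kL).
  apply: eqmx_trans (eqmx_sym (eqmxMr _ (GE _ _))) _.
  by apply: eqmx_trans (GE _ _); apply: GK; rewrite leq_sub2l.
exists K; split=> //.
  (* At [k = i] both flag members are the full space, so [K] is onto. *)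
  rewrite -row_full_unit -sub1mx -(subprodkk theta' i).
  by rewrite -flagK ?leqnn //= submxMl.
move: GKp; rewrite /G subKn // subprodkk => GKp.
have /submxP[Y defY] : (1%:M <= <<1%:M : 'M[F]_(d i)>>)%MS by rewrite genmxE.
have /(congr1 (mulmx Y)) := GKp.
by rewrite !mulmxA -defY !mul1mx.
Qed.

Lemma rank_list_iso {theta theta'} : rank_list theta = rank_list theta' ->
  exists2 J : forall j, 'M[F]_(d j),
    forall j, (j <= L)%N -> J j \in unitmx
    & forall j, (j < L)%N ->
        J j.+1 *m factor theta' j = factor theta j *m J j.
Proof.
move=> rk.
pose carries j (J : 'M[F]_(d j)) := J \in unitmx /\ forall k,
  (j <= k <= L)%N -> (subprod theta k j *m J :=: subprod theta' k j)%MS.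
(* At index 0 there is no map to lift through: [p] and [p'] have zero columns. *)
have [|J0 [J0u _ J0flag]] := @subprod_flag_lift _ _ 0 0 0 0 rk (leq0n L).
  by move=> k _; rewrite !mulmx0.
(* The conditions on [j] and [J] come after the existential, with junk value 0 when they fail, so
   that choice yields a total function that [nat_rect] can iterate. *)
have step j (J : 'M[F]_(d j)) : exists K : 'M[F]_(d j.+1),
    (j < L)%N -> carries j J ->
    carries j.+1 K /\ K *m factor theta' j = factor theta j *m J.
  have [ltjL|] := boolP (j < L)%N; last by exists 0.
  have [[Ju Jflag]|] := pselect (carries j J); last by exists 0.
  have [|K [Ku KJ Kflag]] :=
    subprod_flag_lift (factor theta j *m J) (factor theta' j) rk ltjL.
    move=> k /andP[lt_jk le_kL].
    by rewrite mulmxA -!subprod_recr //; apply: Jflag; rewrite ltnW.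
  by exists K.
pose J j : 'M[F]_(d j) :=
  nat_rect (fun j => 'M[F]_(d j)) J0 (fun j Jj => sval (cid (step j Jj))) j.
have stepJ j := svalP (cid (step j (J j))).
have Jcarries j : (j <= L)%N -> carries j (J j).
  elim: j => [//|j IHj] lt_jL.
  by have [] := stepJ j lt_jL (IHj (ltnW lt_jL)).
exists J => j; first by case/Jcarries.
by move=> lt_jL; have [] := stepJ j lt_jL (Jcarries j (ltnW lt_jL)).
Qed.

(** * Base change and its action on strata *)

Definition base_change (J : forall j, 'M[F]_(d j)) theta : weight F L d :=
  [ffun j : 'I_L => invmx (J j.+1) *m theta j *m J j].

Section BaseChange.
Variable J : forall j, 'M[F]_(d j).

Fact base_change_linear : linear (base_change J).
Proof.
move=> a x y; apply/ffunP => j.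
by rewrite !ffunE mulmxDr mulmxDl -scalemxAr -scalemxAl.
Qed.

HB.instance Definition _ := GRing.isLinear.Build F (weight F L d)
  (weight F L d) *:%R (base_change J) base_change_linear.

Hypothesis J_unit : forall j, (j <= L)%N -> J j \in unitmx.

Lemma factor_base_change theta j : (j < L)%N ->
  factor (base_change J theta) j = invmx (J j.+1) *m factor theta j *m J j.
Proof.
by move=> lt_jL; rewrite -[j]/(val (Ordinal lt_jL)) !factorE ffunE.
Qed.

(** The product telescopes: each inner [J j] cancels against the inverse from the next factor. *)
Lemma subprod_base_change theta k i : (i <= k <= L)%N ->
  subprod (base_change J theta) k i = invmx (J k) *m subprod theta k i *m J i.
Proof.
elim: k => [|k IHk] /andP[].
  by rewrite leqn0 => /eqP -> _; rewrite !subprodkk mulmx1 mulVmx ?J_unit.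
rewrite leq_eqVlt => /predU1P[->|] lekL.
  by rewrite !subprodkk mulmx1 mulVmx ?J_unit.
move=> ltkL; rewrite !subprodS // IHk ?(ltnW ltkL) ?andbT //.
by rewrite factor_base_change // !mulmxA mulmxK // J_unit // ltnW.
Qed.

Lemma rank_list_base_change theta :
  rank_list (base_change J theta) = rank_list theta.
Proof.
apply/rank_listP => k i leikL; rewrite subprod_base_change //.
have/andP[leik lekL] := leikL.
rewrite mxrankMfree ?row_free_unit ?J_unit ?(leq_trans leik) //.
by rewrite -mxrank_tr trmx_mul mxrankMfree ?mxrank_tr // row_free_unit
  unitmx_tr unitmx_inv J_unit.
Qed.

Lemma stratum_base_change W r theta : invmx (J L) *m W *m J 0%N = W ->
  stratum W r theta -> stratum W r (base_change J theta).
Proof.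
move=> JW [muW <-]; split; last exact: rank_list_base_change.
rewrite /fiber /= /mu subprod_base_change ?leq0n ?leqnn //.
by rewrite [subprod _ _ _]muW.
Qed.

Lemma base_changeK :
  cancel (base_change J) (base_change (fun j => invmx (J j))).
Proof.
move=> theta; apply/ffunP => j; rewrite !ffunE invmxK.
by rewrite !mulmxA mulmxV ?J_unit // mul1mx mulmxK // J_unit // ltnW.
Qed.

Lemma base_changeKV :
  cancel (base_change (fun j => invmx (J j))) (base_change J).
Proof.
move=> theta; apply/ffunP => j; rewrite !ffunE invmxK.
by rewrite !mulmxA mulVmx ?J_unit // mul1mx mulmxKV // J_unit // ltnW.
Qed.

End BaseChange.

End WeightIsomorphism.

Theorem corollary15 (R : realType) (L : nat) (d : nat -> nat)
  (L_gt0 : (0 < L)%N) (d_gt0 : forall j : nat, (j <= L)%N -> (0 < d j)%N)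
  (W : 'M[R]_(d L, d 0%N)) (S : set (weight R L d))
  (S_stratum : rank_stratification W S)
  (theta theta' : weight R L d) (S_theta : S theta) (S_theta' : S theta') :
  exists f : {linear weight R L d -> weight R L d},
    [/\ bijective f, f @` S = S & f theta = theta'].
Proof.
case: S_stratum S_theta S_theta' => eta _ <-.
set r := rank_list eta => S_theta S_theta'.
have [muW rk] := S_theta; have [muW' rk'] := S_theta'.
have [J J_unit J_iso] := rank_list_iso (etrans rk (esym rk')).
have Jtheta : base_change J theta = theta'.
  apply/ffunP => j; rewrite ffunE -!factorE -mulmxA -J_iso //.
  by rewrite mulKmx // J_unit.
have JW : invmx (J L) *m W *m J 0%N = W.
  rewrite -{1}muW -[RHS]muW' -Jtheta /mu subprod_base_change //.
  by rewrite leq0n leqnn.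
(* The inverse family fixes [W] too, so the inverse base change also preserves the stratum; this
   gives surjectivity onto it. *)
have JinvW : invmx (invmx (J L)) *m W *m invmx (J 0%N) = W.
  by rewrite invmxK -{1}JW !mulmxA mulmxV ?J_unit // mul1mx mulmxK ?J_unit.
have Jinv_unit j : (j <= L)%N -> invmx (J j) \in unitmx.
  by move=> /J_unit; rewrite unitmx_inv.
exists (base_change J); split=> //.
  by exists (base_change (fun j => invmx (J j)));
    [exact: base_changeK | exact: base_changeKV].
rewrite eqEsubset; split=> [_ [x Sx <-]|x Sx] /=.
  exact: stratum_base_change.
exists (base_change (fun j => invmx (J j)) x); last exact: base_changeKV.
exact: stratum_base_change.
Qed.
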